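(* Let $L$ be a $\mathrm{gl}$-regular Nijenhuis operator on a manifold $\mathsf M$ of dimension $n$, let $\mathrm d f$ be a regular conservation law of $L$, let $u^1,\dots,u^n$ be the (local) second companion coordinates generated by $\mathrm d f$, i.e. such that $\mathrm d u^k=(L^* )^{k-1}\mathrm d f$ for $k=1,\dots,n$, and let $p_1,\dots,p_n$ be the canonical momenta corresponding to the coordinates $u^i$. Let $\widehat L$ be the complete lift of $L$ to $T^*\mathsf M$ and define the operator field $P$ on $T^*\mathsf M$ by $$P=p_1\widehat{\mathrm{Id}}+p_2\widehat L+\dots+p_n\widehat L^{\,n-1}.$$ Then $P\in\mathcal S(\widehat L)$, where $$\mathcal S(\widehat L)=\Big\{Q=h_1\widehat{\mathrm{Id}}+h_2\widehat L+\dots+h_n\widehat L^{\,n-1}\ \Big|\ h_i \text{ smooth functions on } T^*\mathsf M,\ \langle Q,\widehat L\rangle=0\Big\}.$$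
   Context: An operator field is a smooth $(1,1)$-tensor field; it is Nijenhuis if $L^2[\xi,\eta]+[L\xi,L\eta]-L[L\xi,\eta]-L[\xi,L\eta]=0$ for all vector fields $\xi,\eta$. $L$ is $\mathrm{gl}$-regular if $\mathrm{Id},L,\dots,L^{n-1}$ are linearly independent at each point. A conservation law of $L$ is a closed form $\mathrm d f$ with $\mathrm d(L^*\mathrm d f)=0$, $(L^*\alpha)(\xi)=\alpha(L\xi)$; it is regular if $\mathrm d f,L^*\mathrm d f,\dots,(L^* )^{n-1}\mathrm d f$ are linearly independent at each point. For commuting operator fields $A,B$, $$\langle A,B\rangle(\xi,\eta)=AB[\xi,\eta]+[A\xi,B\eta]-A[\xi,B\eta]-B[A\xi,\eta].$$ Complete lift: with $\Omega=\mathrm d p_q\wedge\mathrm d u^q$ and $\Omega_L=\mathrm d(p_qL^q_s\,\mathrm d u^s)$ on $T^*\mathsf M$, the complete lift $\widehat L$ is the operator field on $T^*\mathsf M$ defined by $\Omega(\cdot,\widehat L\,\cdot)=\Omega_L(\cdot,\cdot)$; in canonical coordinates ordered as $(p,u)$, $\widehat L=\begin{pmatrix}L^\top&R\\0&L\end{pmatrix}$ with $R_{ij}=\big(\frac{\partial L^q_i}{\partial u^j}-\frac{\partial L^q_j}{\partial u^i}\big)p_q$. $\widehat{\mathrm{Id}}$ is the identity operator field on $T^*\mathsf M$. *)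

(* Defs.v *)
From HB Require Import structures.
From mathcomp Require Import all_boot all_order all_algebra.
From mathcomp Require Import all_classical all_reals all_analysis.

Set Implicit Arguments.
Unset Strict Implicit.
Unset Printing Implicit Defensive.

Import Order.TTheory GRing.Theory Num.Theory.
Import numFieldNormedType.Exports.

Local Open Scope classical_set_scope.
Local Open Scope ring_scope.

(* Points and tangent vectors of R^n are column vectors, covectors are row
   vectors, and an operator (L^i_j) acts by [L *m v] on vectors and by
   [alpha *m L] on covectors, the latter being the dual operator L^*. *)

(** * Calculus on open subsets of R^N *)

Section Calculus.
Context {R : realType}.

Fixpoint Ck {V W : normedModType R} (k : nat) (U : set V) (f : V -> W) : Prop :=
  match k with
  | 0 => forall x, U x -> {for x, continuous f}
  | k'.+1 => (forall x, U x -> differentiable f x) /\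
             (forall v : V, Ck k' U ('D_v f))
  end.

Definition smooth {V W : normedModType R} (U : set V) (f : V -> W) : Prop :=
  forall k, Ck k U f.

Section Fields.
Context {N : nat}.
Implicit Types (U : set 'cV[R]_N) (xi eta : 'cV[R]_N -> 'cV[R]_N)
  (A B : 'cV[R]_N -> 'M[R]_N).

Definition lie_bracket xi eta : 'cV[R]_N -> 'cV[R]_N :=
  fun x => 'D_(xi x) eta x - 'D_(eta x) xi x.

Definition op_app A xi : 'cV[R]_N -> 'cV[R]_N := fun x => A x *m xi x.

Definition differential (f : 'cV[R]_N -> R) : 'cV[R]_N -> 'rV[R]_N :=
  fun x => \row_j 'D_(delta_mx j 0) (f : 'cV[R]_N -> R^o) x.

Definition pullback A (alpha : 'cV[R]_N -> 'rV[R]_N) : 'cV[R]_N -> 'rV[R]_N :=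
  fun x => alpha x *m A x.

(* d alpha (v, w) = v(alpha(w)) - w(alpha(v)) for constant v and w, that is
   \sum_(i, j) (d_i alpha_j - d_j alpha_i) v^i w^j. *)
Definition ext_d (alpha : 'cV[R]_N -> 'rV[R]_N) (x v w : 'cV[R]_N) : R :=
  'D_v (fun y => (alpha y *m w) 0 0 : R^o) x -
  'D_w (fun y => (alpha y *m v) 0 0 : R^o) x.

Definition nijenhuis_on U A : Prop :=
  forall xi eta, smooth U xi -> smooth U eta -> forall x, U x ->
    op_app A (op_app A (lie_bracket xi eta)) x + lie_bracket (op_app A xi) (op_app A eta) x
    - op_app A (lie_bracket (op_app A xi) eta) x
    - op_app A (lie_bracket xi (op_app A eta)) x = 0.

Definition pairing A B xi eta : 'cV[R]_N -> 'cV[R]_N := fun x =>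
  op_app A (op_app B (lie_bracket xi eta)) x + lie_bracket (op_app A xi) (op_app B eta) x
  - op_app A (lie_bracket xi (op_app B eta)) x
  - op_app B (lie_bracket (op_app A xi) eta) x.

Definition pairing_vanishes_on U A B : Prop :=
  forall xi eta, smooth U xi -> smooth U eta ->
    forall x, U x -> pairing A B xi eta x = 0.

End Fields.
End Calculus.

(** * Smooth manifolds and tensor fields, through coordinate charts *)

Section Charts.
Context {R : realType}.

Record chart (T : topologicalType) (n : nat) := Chart {
  dom : set T;
  crd : T -> 'cV[R]_n;
  par : 'cV[R]_n -> T;
  dom_open : open dom;
  img_open : open (crd @` dom);
  crdK : forall x, dom x -> par (crd x) = x;
  crd_cont : {within dom, continuous crd};
  par_cont : {within (crd @` dom), continuous par} }.

Definition img T n (c : chart T n) : set 'cV[R]_n := crd c @` dom c.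

Definition transition T n (c c' : chart T n) : 'cV[R]_n -> 'cV[R]_n :=
  crd c' \o par c.

Definition compatible T n (c c' : chart T n) : Prop :=
  smooth (crd c @` (dom c `&` dom c')) (transition c c') /\
  smooth (crd c' @` (dom c `&` dom c')) (transition c' c).

End Charts.
Arguments chart R T n : clear implicits.

Record manifold (R : realType) (n : nat) := Manifold {
  carrier :> topologicalType;
  atlas : set (chart R carrier n);
  manifold_hausdorff : hausdorff_space carrier;
  manifold_second_countable : @second_countable carrier;
  atlas_cover : forall x : carrier, exists2 c, atlas c & dom c x;
  atlas_compatible : forall c c', atlas c -> atlas c' -> compatible c c' }.

Section Manifold.
Context {R : realType} {n : nat} (M : manifold R n).

(* Membership in the maximal atlas: c is a local coordinate system on M. *)
Definition coordinates (c : chart R M n) : Prop :=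
  forall c', atlas c' -> compatible c c'.

Definition smooth_function (f : M -> R) : Prop :=
  forall c, coordinates c -> smooth (img c) (f \o par c : 'cV[R]_n -> R^o).

(* A (1,1)-tensor field is the family of its components in all the local
   coordinate systems, subject to the tensor transformation law. *)
Record operator_field := OperatorField {
  components :> chart R M n -> 'cV[R]_n -> 'M[R]_n;
  components_smooth : forall c, coordinates c -> smooth (img c) (components c);
  components_transition : forall c c', coordinates c -> coordinates c' ->
    forall x, dom c x -> dom c' x -> forall v : 'cV[R]_n,
      'D_(components c (crd c x) *m v) (transition c c') (crd c x) =
      components c' (crd c' x) *m 'D_v (transition c c') (crd c x) }.

Implicit Types (L : operator_field) (f : M -> R).

Definition nijenhuis L : Prop :=
  forall c, coordinates c -> nijenhuis_on (img c) (L c).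

Definition gl_regular L : Prop :=
  forall c, coordinates c -> forall y, img c y ->
    free (mkseq (fun i => (L c y) ^+ i) n).

(* The components in the coordinates c of df pulled back i times by L. *)
Definition iter_dual L f (i : nat) (c : chart R M n) : 'cV[R]_n -> 'rV[R]_n :=
  iter i (pullback (L c)) (differential (f \o par c)).

Definition conservation_law L f : Prop :=
  smooth_function f /\
  forall c, coordinates c -> forall y, img c y -> forall v w,
    ext_d (iter_dual L f 1 c) y v w = 0.

Definition regular_conservation_law L f : Prop :=
  conservation_law L f /\
  forall c, coordinates c -> forall y, img c y ->
    free (mkseq (fun i => iter_dual L f i c y) n).

(* Indices are 0-based: du^k is df pulled back k times by L, k = 0, ..., n - 1. *)
Definition second_companion_coordinates L f (u : chart R M n) : Prop :=
  coordinates u /\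
  forall c, coordinates c -> forall x, dom c x -> dom u x ->
    forall k : 'I_n,
      differential (fun y => crd u (par c y) k 0) (crd c x) =
      iter_dual L f k c (crd c x).

End Manifold.

(** * The cotangent bundle over a coordinate domain *)

(* If u is a coordinate system on V, then T^*V has the global canonical
   coordinates z = col_mx p u, with values in R^n x img u, so that operator
   fields on T^*V are matrix-valued functions of z. *)

Section Cotangent.
Context {R : realType} {n : nat}.
Implicit Types (U : set 'cV[R]_n) (A : 'cV[R]_n -> 'M[R]_n)
  (z v w : 'cV[R]_(n + n)).

Definition momentum z : 'cV[R]_n := usubmx z.
Definition position z : 'cV[R]_n := dsubmx z.

Definition cotangent_over U : set 'cV[R]_(n + n) := [set z | U (position z)].

(* Omega = \sum_q dp_q /\ du^q *)
Definition Omega v w : R :=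
  \sum_(q < n) (momentum v q 0 * position w q 0
                - momentum w q 0 * position v q 0).

(* The 1-form \sum_(q, s) p_q L^q_s du^s *)
Definition twisted_liouville A z : 'rV[R]_(n + n) :=
  row_mx 0 ((momentum z)^T *m A (position z)).

Definition Omega_twisted A z v w : R := ext_d (twisted_liouville A) z v w.

Definition complete_lift U A (Ahat : 'cV[R]_(n + n) -> 'M[R]_(n + n)) : Prop :=
  forall z, cotangent_over U z ->
    forall v w, Omega v (Ahat z *m w) = Omega_twisted A z v w.

Definition symmetry_family U (Ahat : 'cV[R]_(n + n) -> 'M[R]_(n + n)) :
    set ('cV[R]_(n + n) -> 'M[R]_(n + n)) :=
  [set Q | (exists h : 'I_n -> 'cV[R]_(n + n) -> R,
              (forall i, smooth (cotangent_over U)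
                           (h i : 'cV[R]_(n + n) -> R^o)) /\
              (forall z, cotangent_over U z ->
                 Q z = \sum_(i < n) h i z *: Ahat z ^+ i)) /\
           pairing_vanishes_on (cotangent_over U) Q Ahat].

Definition momentum_operator (Ahat : 'cV[R]_(n + n) -> 'M[R]_(n + n))
    (z : 'cV[R]_(n + n)) : 'M[R]_(n + n) :=
  \sum_(i < n) momentum z i 0 *: Ahat z ^+ i.

End Cotangent.

(* Main.v *)
(* In companion coordinates du^k = L^* du^(k-1), so L is a companion matrix: every
   row but the last is constant.  Together with the vanishing torsion of L this
   yields, for all vectors v and w,
     (D_v L) w = (D_w L) v   and   D_(L v) L = (D_v L) L.
   The first identity says that all L^* du^k are closed, so that R = 0 and the
   complete lift is block diagonal, with blocks L^T and L; the second one says that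
   this block diagonal operator is again Nijenhuis.  For P = \sum_i p_i Lhat^i the
   terms of <P, Lhat> without derivatives of p_i then vanish, and the others amount
   to \sum_i (Lhat^* dp_i) Lhat^i = \sum_i dp_i Lhat^(i+1), which is the identity
   \sum_i C_(k i) C^i = C^(k+1) satisfied by any companion matrix C; for the last
   row k it is the Cayley-Hamilton theorem. *)
Require Import Defs.
From HB Require Import structures.
From mathcomp Require Import all_boot all_order all_algebra.
From mathcomp Require Import all_classical all_reals all_analysis.
From mathcomp Require Import ring zify.

Set Implicit Arguments.
Unset Strict Implicit.
Unset Printing Implicit Defensive.

Import Order.TTheory GRing.Theory Num.Theory.
Import numFieldNormedType.Exports.

Local Open Scope classical_set_scope.
Local Open Scope ring_scope.

(** * Companion matrices and block-diagonal lifts *)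

Section Companion.
Context {R : comPzRingType} {n : nat}.
Implicit Types C : 'M[R]_n.

Definition companion C : Prop :=
  forall i j : 'I_n, j = i.+1 :> nat -> row i C = delta_mx 0 j.

(** The first basis covector is cyclic: each right multiplication by [C] moves it to the next one,
    as long as a next one exists. *)
Lemma companion_cyclic C (i0 i : 'I_n) :
  companion C -> i0 = 0 :> nat -> delta_mx 0 i0 *m C ^+ i = delta_mx 0 i :> 'rV_n.
Proof.
move=> cC i00; case: i => i; elim: i => [|i IH] ltin /=.
  by rewrite expr0 mulmx1; congr delta_mx; apply/val_inj.
rewrite exprSr -mulmxE mulmxA (IH (ltnW ltin)) -rowE.
exact: cC.
Qed.

(** Write [e_m] as [e_0 C^m] in row [m] of both sides. Powers of [C] commute, so all reduces to
    [e_0 C^(k+1) = e_k C], which is row [k] of [C], expanded in the basis [e_i = e_0 C^i]. *)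
Lemma companion_charpoly C (k : 'I_n) :
  companion C -> \sum_(i < n) C k i *: C ^+ i = C ^+ k.+1.
Proof.
move=> cC; pose i0 := Ordinal (leq_ltn_trans (leq0n k) (ltn_ord k)).
apply/row_matrixP => m; rewrite !rowE -(companion_cyclic m cC (erefl : i0 = 0%N :> nat)).
have -> : delta_mx 0 i0 *m C ^+ m *m C ^+ k.+1 = row k C *m C ^+ m :> 'rV_n.
  rewrite rowE -(companion_cyclic k cC (erefl : i0 = 0%N :> nat)) -!mulmxA !mulmxE.
  by rewrite -exprS -!exprD addnC addSnnS.
rewrite [row k C]row_sum_delta mulmx_sumr mulmx_suml; apply: eq_bigr => i _.
rewrite -scalemxAr -scalemxAl mxE -(companion_cyclic i cC (erefl : i0 = 0%N :> nat)).
by rewrite -!mulmxA !mulmxE -!exprD addnC.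
Qed.

(** The previous identity weighted by [b k] and summed over [k]. In the application [b] is the
    momentum part of a tangent vector and [C^T *m b] that of its image under the lift. *)
Lemma companion_dual C (b : 'cV[R]_n) :
  companion C ->
  \sum_(i < n) (C^T *m b) i 0 *: C ^+ i = \sum_(i < n) b i 0 *: C ^+ i.+1.
Proof.
move=> cC; under [RHS]eq_bigr => k _ do rewrite -(companion_charpoly k cC) scaler_sumr.
rewrite exchange_big; apply: eq_bigr => i _; rewrite mxE scaler_suml.
by apply: eq_bigr => k _; rewrite mxE scalerA mulrC.
Qed.

(** The complete lift in the case [R = 0], momenta first. *)
Definition cotangent_lift C : 'M[R]_(n + n) := block_mx C^T 0 0 C.

Lemma cotangent_lift_exp C i : cotangent_lift C ^+ i = cotangent_lift (C ^+ i).
Proof.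
elim: i => [|i IH]; first by rewrite !expr0 /cotangent_lift trmx1 -scalar_mx_block.
rewrite exprSr IH -mulmxE /cotangent_lift mulmx_block.
by rewrite !(mulmx0, mul0mx, addr0, add0r) -trmx_mul !mulmxE -exprS -exprSr.
Qed.

Lemma cotangent_lift_sum m (h : 'I_m -> R) (X : 'I_m -> 'M[R]_n) :
  \sum_(i < m) h i *: cotangent_lift (X i) =
  cotangent_lift (\sum_(i < m) h i *: X i).
Proof.
elim/big_rec2: _ => [|i Y _ _ ->].
  by rewrite /cotangent_lift trmx0 -[RHS]/(block_mx 0 0 0 0) block_mx0.
by rewrite /cotangent_lift scale_block_mx !scaler0 add_block_mx !addr0
  !linearD/= linearZ.
Qed.

End Companion.

(** [D] stands for the derivative of [C] at a point, and the last hypothesis for vanishing torsion.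
    In row [i - 1] of the latter the first two terms vanish, while row [i - 1] of [C] is a basis
    covector that picks out row [i] of [D v *m w - D w *m v]. *)
Lemma companion_derivation {R : comPzRingType} {n : nat}
    (C : 'M[R]_n) (D : {linear 'cV[R]_n -> 'M[R]_n}) :
  companion C ->
  (forall (i : 'I_n) v, (i.+1 < n)%N -> row i (D v) = 0) ->
  (forall v w, D (C *m v) *m w - D (C *m w) *m v
               - C *m (D v *m w) + C *m (D w *m v) = 0) ->
  (forall v w, D v *m w = D w *m v) /\ (forall v, D (C *m v) = D v *m C).
Proof.
move=> cC D0 tD.
have Dsym v w : D v *m w = D w *m v.
  apply/row_matrixP => i; rewrite !row_mul.
  have [ltin|gein] := ltnP i.+1 n; first by rewrite !D0 ?mul0mx.
  (* Row 0 has no predecessor; being also the last row, it forces [n = 1], where all vectors are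
     multiples of one vector. *)
  have [i0|i0] := eqVneq (i : nat) 0%N.
    have n1 : n = 1%N by have := ltn_ord i; lia.
    subst n; have E (u : 'cV[R]_1) : u = u 0 0 *: (1%:M : 'M[R]_1).
      by apply/matrixP => a b; rewrite !ord1 !mxE eqxx mulr1.
    rewrite (E v) (E w) !linearZ/= -!scalemxAl !scalerA.
    by rewrite mulrC.
  have ltj : (i.-1 < n)%N by exact: leq_ltn_trans (leq_pred i) (ltn_ord i).
  pose j := Ordinal ltj; have ji : i = j.+1 :> nat by rewrite /=; lia.
  have /(congr1 (row j)) := tD v w; rewrite !linearD/= !linearN/= !row_mul.
  rewrite (cC j i ji) !(D0 j) -?ji// !mul0mx oppr0 !add0r row0 -!rowE !row_mul.
  by move=> /eqP; rewrite addrC subr_eq0 => /eqP.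
(* By symmetry the torsion reduces to [D (C v) w = D (C w) v], whose right side is [D v (C w)]. *)
split=> // v; apply/matrixP => i j; pose w : 'cV[R]_n := delta_mx j 0.
suff /colP/(_ i) : D (C *m v) *m w = D v *m C *m w by rewrite -!colE !mxE.
apply/eqP; rewrite -mulmxA [D v *m _]Dsym -subr_eq0 -[X in _ == X](tD v w).
by rewrite (Dsym v w) subrK.
Qed.

(** * Directional derivatives of matrix-valued maps, entry by entry *)

Section MatrixDerivatives.
Context {R : realType} {V : normedModType R}.
Implicit Types x v : V.

Lemma is_derive_mxP {m k} (F : V -> 'M[R]_(m, k)) x v (dF : 'M[R]_(m, k)) :
  is_derive x v F dF <->
  forall i j, is_derive x v (fun y => F y i j) (dF i j).
Proof.
split=> [[Fd <-] i j|Fd].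
  have /derivable_mxP Fd' := Fd.
  by apply: DeriveDef => //; rewrite derive_mx// mxE.
have Fx : derivable F x v by apply/derivable_mxP => i j; case: (Fd i j).
apply: DeriveDef => //; rewrite derive_mx//; apply/matrixP => i j; rewrite mxE.
by case: (Fd i j).
Qed.

Lemma is_derive_mulmx {m k l} (F : V -> 'M[R]_(m, k)) (G : V -> 'M[R]_(k, l))
    x v dF dG :
  is_derive x v F dF -> is_derive x v G dG ->
  is_derive x v (fun y => F y *m G y) (dF *m G x + F x *m dG).
Proof.
move=> /is_derive_mxP Fd /is_derive_mxP Gd; apply/is_derive_mxP => i j.
have := @is_derive_sum _ _ _ k (fun q => (fun y => F y i q) * (fun y => G y q j))
  x v _ (fun q => is_deriveM (Fd i q) (Gd q j)).
rewrite (_ : \sum_(q < k) _ = fun y => (F y *m G y) i j); last first.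
  by apply/funext => y; rewrite fct_sumE mxE; apply: eq_bigr.
move=> Hd; apply: is_derive_eq; rewrite !mxE -big_split/=.
by apply: eq_bigr => q _; rewrite addrC [_ *: dF i q]mulrC.
Qed.

Lemma is_derive_scalemx {m k} (h : V -> R) (F : V -> 'M[R]_(m, k)) x v dh dF :
  is_derive x v h dh -> is_derive x v F dF ->
  is_derive x v (fun y => h y *: F y) (dh *: F x + h x *: dF).
Proof.
move=> hd /is_derive_mxP Fd; apply/is_derive_mxP => i j.
rewrite (_ : (fun y => _) = h * (fun y => F y i j)); last first.
  by apply/funext => y; rewrite mxE.
have Fij := Fd i j.
by apply: is_derive_eq; rewrite !mxE addrC [_ *: dh]mulrC.
Qed.

(* The ascription matters: 'D_v F x is typed in a join of normed module structures,
   on which matrix rewriting is prohibitively slow. *)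
Definition dmx {m k} (F : V -> 'M[R]_(m, k)) x v : 'M[R]_(m, k) := 'D_v F x.

Lemma is_derive_dmx {m k} (F : V -> 'M[R]_(m, k)) x v :
  derivable F x v -> is_derive x v F (dmx F x v).
Proof. by move=> Fd; apply: DeriveDef. Qed.

Lemma is_derive_dmxE {m k} (F : V -> 'M[R]_(m, k)) x v dF :
  is_derive x v F dF -> dmx F x v = dF.
Proof. by case. Qed.

End MatrixDerivatives.

(** * Pointwise values of the pairing, on powers and on combinations *)

Section Torsion.
Context {R : realType} {N : nat}.
Implicit Types (A B : 'cV[R]_N -> 'M[R]_N) (x v w : 'cV[R]_N).

(* For commuting A and B the pairing of A and B is tensorial; these are its
   values. *)
Definition torsion A B x v w : 'cV[R]_N :=
  dmx B x (A x *m v) *m w - dmx A x (B x *m w) *m v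
  - A x *m (dmx B x v *m w) + B x *m (dmx A x w *m v).

(** The derivatives of [eta] cancel identically, those of [xi] because [A] and [B] commute at
    [x]. *)
Lemma pairingE A B (xi eta : 'cV[R]_N -> 'cV[R]_N) x :
  (forall v, derivable A x v) -> (forall v, derivable B x v) ->
  (forall v, derivable xi x v) -> (forall v, derivable eta x v) ->
  A x *m B x = B x *m A x ->
  pairing A B xi eta x = torsion A B x (xi x) (eta x).
Proof.
move=> dA dB dxi deta AB.
have D F (zeta : 'cV[R]_N -> 'cV[R]_N) v : (forall v, derivable F x v) ->
    (forall v, derivable zeta x v) ->
    dmx (op_app F zeta) x v = dmx F x v *m zeta x + F x *m dmx zeta x v.
  move=> dF dz; apply: is_derive_dmxE.
  exact: is_derive_mulmx (is_derive_dmx (dF v)) (is_derive_dmx (dz v)).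
have -> : pairing A B xi eta x =
    A x *m (B x *m (dmx eta x (xi x) - dmx xi x (eta x))) +
    (dmx (op_app B eta) x (A x *m xi x) - dmx (op_app A xi) x (B x *m eta x)) -
    A x *m (dmx (op_app B eta) x (xi x) - dmx xi x (B x *m eta x)) -
    B x *m (dmx eta x (A x *m xi x) - dmx (op_app A xi) x (eta x)) by [].
rewrite !(D A xi _ dA dxi) !(D B eta _ dB deta) /torsion.
(* With the derivatives replaced by arbitrary matrices, only matrix algebra remains. *)
repeat match goal with |- context [dmx ?F x ?v] => move: (dmx F x v) => ? end.
rewrite !(mulmxBr, mulmxDr) !mulmxA AB.
by apply/matrixP => i j; rewrite !mxE; ring.
Qed.

(** Induction through [T(B^(i+1), B)(v, w) = T(B, B)(B^i v, w) + B T(B^i, B)(v, w)], which follows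
    from the product rule. *)
Lemma torsion_pow B x :
  (forall v, derivable B x v) -> (forall v w, torsion B B x v w = 0) ->
  forall i, (forall v, derivable (fun y => B y ^+ i) x v) /\
    forall v w, torsion (fun y => B y ^+ i) B x v w = 0.
Proof.
move=> dB tB; elim=> [|i [dBi tBi]].
  split=> [v|v w]; first exact: derivable_cst.
  by rewrite /torsion /dmx !expr0 !mul1mx !derive_cst !mul0mx mulmx0 subr0 addr0 subrr.
pose P : 'cV[R]_N -> 'M[R]_N := fun y => B y ^+ i.
have D v : is_derive x v (fun y => B y ^+ i.+1)
    (dmx B x v *m P x + B x *m dmx P x v).
  rewrite (_ : (fun y => _) = fun y => B y *m P y); last first.
    by apply/funext => y; rewrite exprS.
  exact: is_derive_mulmx (is_derive_dmx (dB v)) (is_derive_dmx (dBi v)).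
have DE v := is_derive_dmxE (D v).
split=> [v|v w]; first by case: (D v).
transitivity (torsion B B x (P x *m v) w + B x *m torsion P B x v w); last first.
  by rewrite tB tBi mulmx0 addr0.
rewrite /torsion !DE exprS -mulmxE -/(P x) -!mulmxA.
repeat match goal with |- context [dmx ?F x ?v] => move: (dmx F x v) => ? end.
rewrite !(mulmxBr, mulmxDr, mulmxDl, mulmxN) !mulmxA.
by apply/matrixP => j k; rewrite !mxE; ring.
Qed.

(** The algebra behind [torsion_comb]: [b] is [B x], [c] its derivative along [v]; the indices 1 and
    2 of [g] and [dQ] mark derivatives along [B x *m w] and [w]. *)
Lemma torsion_comb_aux n (b c : 'M[R]_N) (h g1 g2 : 'I_n -> R)
    (Q D1 dQ1 dQ2 : 'I_n -> 'M[R]_N) v w :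
  (\sum_(i < n) h i *: D1 i) *m w
  - (\sum_(i < n) (g1 i *: Q i + h i *: dQ1 i)) *m v
  - (\sum_(i < n) h i *: Q i) *m (c *m w)
  + b *m ((\sum_(i < n) (g2 i *: Q i + h i *: dQ2 i)) *m v) =
  \sum_(i < n) h i *: (D1 i *m w - dQ1 i *m v - Q i *m (c *m w) + b *m (dQ2 i *m v)) +
  (b *m (\sum_(i < n) g2 i *: Q i) - \sum_(i < n) g1 i *: Q i) *m v.
Proof.
rewrite mulmxBl -mulmxA !mulmx_suml !mulmx_sumr -!sumrN -!big_split /=.
apply: eq_bigr => i _.
rewrite !(mulmxDl, mulmxDr) -!(scalemxAl, scalemxAr).
by apply/matrixP => j k; rewrite !mxE; ring.
Qed.

(** Leibniz rule: the second summand collects the derivatives of the coefficients. Linearity of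
    [dmx B x] serves to split the derivative of [B] along [\sum_i h i x *: Q i x *m v]. *)
Lemma torsion_comb n (h : 'I_n -> 'cV[R]_N -> R)
    (Q : 'I_n -> 'cV[R]_N -> 'M[R]_N) B x :
  linear (dmx B x) ->
  (forall i v, derivable (h i) x v) -> (forall i v, derivable (Q i) x v) ->
  (forall v, derivable (fun y => \sum_(i < n) h i y *: Q i y) x v) /\
  forall v w,
  torsion (fun y => \sum_(i < n) h i y *: Q i y) B x v w =
  \sum_(i < n) h i x *: torsion (Q i) B x v w +
  (B x *m (\sum_(i < n) 'D_w (h i) x *: Q i x) -
   \sum_(i < n) 'D_(B x *m w) (h i) x *: Q i x) *m v.
Proof.
move=> Blin dh dQ.
pose DBlin := GRing.isLinear.Build _ _ _ _ _ Blin.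
pose DB : {linear _ -> _} := HB.pack (dmx B x) DBlin.
have D v : is_derive x v (fun y => \sum_(i < n) h i y *: Q i y)
    (\sum_(i < n) ('D_v (h i) x *: Q i x + h i x *: dmx (Q i) x v)).
  rewrite (_ : (fun y => _) = \sum_(i < n) (fun y => h i y *: Q i y)); last first.
    by apply/funext => y; rewrite fct_sumE.
  by apply: is_derive_sum => i; apply: is_derive_scalemx;
    [exact: derivableP|exact: is_derive_dmx].
have DE v := is_derive_dmxE (D v).
split=> [v|v w]; first by case: (D v).
rewrite /torsion !DE.
have -> : dmx B x ((\sum_(i < n) h i x *: Q i x) *m v) =
    \sum_(i < n) h i x *: dmx B x (Q i x *m v).
  rewrite mulmx_suml -[dmx B x]/(DB : _ -> _) linear_sum; apply: eq_bigr => i _.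
  by rewrite -scalemxAl linearZ.
exact: torsion_comb_aux.
Qed.

End Torsion.

(** * Smooth maps and the torsion of a Nijenhuis operator *)

Section Smooth.
Context {R : realType}.

Lemma smooth_cst {V W : normedModType R} (U : set V) (c : W) : smooth U (cst c).
Proof.
move=> k; elim: k c => [|k IH] c /=; first by move=> x _; exact: cst_continuous.
split=> [x _|v]; first exact: differentiable_cst.
rewrite (_ : 'D_v _ = cst 0); first exact: IH.
by apply/funext => x; rewrite derive_cst.
Qed.

Lemma is_derive_coord {N : nat} (x v : 'cV[R]_N) i :
  is_derive x v (fun z : 'cV[R]_N => z i 0) (v i 0).
Proof. by have /is_derive_mxP := @is_derive_id _ _ x v; apply. Qed.

Lemma smooth_coord {N : nat} (U : set 'cV[R]_N) i :
  smooth U (fun z : 'cV[R]_N => z i 0 : R^o).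
Proof.
case=> [|k] /=; first by move=> x _; exact: coord_continuous.
split=> [x _|v]; first exact: differentiable_coord.
rewrite (_ : 'D_v _ = cst (v i 0)); first exact: smooth_cst.
by apply/funext => x; have [_] := is_derive_coord x v i.
Qed.

Lemma smooth_differentiable {V W : normedModType R} (U : set V) (F : V -> W) x :
  smooth U F -> U x -> differentiable F x.
Proof. by move=> /(_ 1%N)[+ _] => /[apply]. Qed.

Lemma smooth_derivable {V W : normedModType R} (U : set V) (F : V -> W) x :
  smooth U F -> U x -> forall v, derivable F x v.
Proof. by move=> sF Ux v; exact/diff_derivable/smooth_differentiable/Ux. Qed.

Lemma dmx_linear {V : normedModType R} {m k} (F : V -> 'M[R]_(m, k)) x :
  differentiable F x -> linear (dmx F x).
Proof. by move=> dF a v w; rewrite /dmx !deriveE// linearP. Qed.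

(** By tensoriality it is enough to test on constant fields. *)
Lemma nijenhuis_torsion {N : nat} (U : set 'cV[R]_N) A x :
  (forall v, derivable A x v) -> nijenhuis_on U A -> U x ->
  forall v w, torsion A A x v w = 0.
Proof.
move=> dA nA Ux v w.
have := nA (cst v) (cst w) (smooth_cst U v) (smooth_cst U w) x Ux.
(* [nijenhuis_on] and [pairing] list their last two terms in opposite orders. *)
by rewrite addrAC -/(pairing A A (cst v) (cst w) x) pairingE.
Qed.

End Smooth.

(** * The operator in its second companion coordinates *)

Section CompanionCoordinates.
Context {R : realType} {n : nat} (M : manifold R n).
Context (L : operator_field M) (f : M -> R) (u : chart R M n).

Lemma differential_crd y (k : 'I_n) :
  img u y -> differential (fun y => crd u (par u y) k 0) y = delta_mx 0 k.
Proof.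
move=> Uy; apply/rowP => j; rewrite !mxE eqxx/=.
rewrite (@near_eq_derive _ _ _ _ (fun z : 'cV[R]_n => z k 0)); last first.
  near=> z.
  have [t ut <-] : img u z by near: z; apply: open_nbhs_nbhs; split=> //; exact: img_open.
  by rewrite crdK.
have [_ ->] := is_derive_coord y (delta_mx j 0) k.
by rewrite mxE eqxx andbT eq_sym.
Unshelve. all: by end_near. Qed.

(** The defining relation is read in the chart [u] itself, where the [du^k] are the basis
    covectors. *)
Lemma companion_coordinates y :
  second_companion_coordinates L f u -> img u y -> companion (L u y).
Proof.
move=> [cu du] Uy i j ji; have [x ux xy] := Uy.
rewrite rowE -(differential_crd j Uy) -(differential_crd i Uy) -xy !du//.
by rewrite ji.
Qed.

(** The companion form holds on the open set [img u], so these rows are locally constant. *)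
Lemma row_dmx_coordinates y (i : 'I_n) v :
  second_companion_coordinates L f u -> img u y -> (i.+1 < n)%N ->
  row i (dmx (L u) y v) = 0.
Proof.
move=> Lfu Uy ltin; have [cu _] := Lfu; apply/rowP => j; rewrite !mxE.
have dL := smooth_derivable (components_smooth L cu) Uy.
have /is_derive_mxP/(_ i j)[_ <-] := is_derive_dmx (dL v).
have <- := derive_cst (delta_mx 0 (Ordinal ltin) (0 : 'I_1) j : R^o) y v.
apply: near_eq_derive; near=> z.
have Uz : img u z by near: z; apply: open_nbhs_nbhs; split=> //; exact: img_open.
have /rowP/(_ j) := companion_coordinates Lfu Uz (erefl : Ordinal ltin = i.+1 :> nat).
by rewrite mxE.
Unshelve. all: by end_near. Qed.

Lemma dmx_coordinates y :
  second_companion_coordinates L f u -> nijenhuis L -> img u y ->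
  (forall v w, dmx (L u) y v *m w = dmx (L u) y w *m v) /\
  (forall v, dmx (L u) y (L u y *m v) = dmx (L u) y v *m L u y).
Proof.
move=> Lfu nL Uy; have [cu _] := Lfu.
have sL := components_smooth L cu.
have lin := dmx_linear (smooth_differentiable sL Uy).
pose Dlin := GRing.isLinear.Build _ _ _ _ _ lin.
pose D : {linear _ -> _} := HB.pack (dmx (L u) y) Dlin.
apply: (@companion_derivation _ _ (L u y) D).
- exact: (companion_coordinates Lfu).
- by move=> i v; exact: (row_dmx_coordinates v Lfu).
- by move=> v w; exact: (nijenhuis_torsion (smooth_derivable sL Uy) (nL _ cu) Uy).
Qed.

End CompanionCoordinates.

(** * Canonical coordinates, the symplectic form and the complete lift *)

Section CotangentBundle.
Context {R : realType} {n : nat}.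
Implicit Types (U : set 'cV[R]_n) (A : 'cV[R]_n -> 'M[R]_n)
  (Ahat : 'cV[R]_(n + n) -> 'M[R]_(n + n)) (z v w : 'cV[R]_(n + n)).

(** As [position] is linear, the difference quotients agree; directional derivability of [F] is
    enough. *)
Lemma is_derive_position {W : normedModType R} (F : 'cV[R]_n -> W) z v dF :
  is_derive (position z) (position v) F dF -> is_derive z v (F \o position) dF.
Proof.
move=> [Fd <-].
have E : (fun h => h^-1 *: ((F \o position \o shift z) (h *: v) - (F \o position) z)) =
    (fun h => h^-1 *: ((F \o shift (position z)) (h *: position v) - F (position z))).
  apply/funext => h /=; congr (_ *: (F _ - _)).
  by apply/matrixP => i j; rewrite !mxE.
by apply: DeriveDef; rewrite /derivable /derive E.
Qed.

Lemma open_cotangent_over U : open U -> open (cotangent_over U).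
Proof.
move=> oU; apply: (@open_comp _ _ position) => // z _ B /nbhs_ballP[e /= e0 eB].
apply/nbhs_ballP; exists e => //= y [_ zy]; apply: eB; split=> // i j.
by apply: le_lt_trans (zy (rshift n i) j); rewrite !mxE.
Qed.

Lemma smooth_momentum U (i : 'I_n) :
  smooth (cotangent_over U) (fun z => momentum z i 0 : R^o).
Proof.
rewrite (_ : (fun z => _) = fun z => z (lshift n i) 0); first exact: smooth_coord.
by apply/funext => z; rewrite mxE.
Qed.

Lemma is_derive_momentum z v (i : 'I_n) :
  is_derive z v (fun z => momentum z i 0) (momentum v i 0).
Proof.
rewrite (_ : (fun z => _) = fun z => z (lshift n i) 0); last first.
  by apply/funext => y; rewrite mxE.
by rewrite mxE; exact: is_derive_coord.
Qed.

Lemma is_derive_cotangent_lift A Ahat z v :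
  (forall a, derivable A (position z) a) ->
  (\near z, Ahat z = cotangent_lift (A (position z))) ->
  is_derive z v Ahat (cotangent_lift (dmx A (position z) (position v))).
Proof.
move=> dA AhatE.
apply: (@near_eq_is_derive _ _ _ (fun z => cotangent_lift (A (position z)))).
  by apply: filterS AhatE => y ->.
have /is_derive_mxP dAz := is_derive_position (is_derive_dmx (dA (position v))).
apply/is_derive_mxP => i j.
case: (split_ordP i) => i' ->; case: (split_ordP j) => j' ->.
- rewrite block_mxEul mxE (_ : (fun y => _) = fun y => (A \o position) y j' i') //.
  by apply/funext => y; rewrite block_mxEul mxE.
- rewrite block_mxEur mxE (_ : (fun y => _) = cst (0 : R^o)); first exact: is_derive_cst.
  by apply/funext => y; rewrite block_mxEur mxE.
- rewrite block_mxEdl mxE (_ : (fun y => _) = cst (0 : R^o)); first exact: is_derive_cst.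
  by apply/funext => y; rewrite block_mxEdl mxE.
- rewrite block_mxEdr (_ : (fun y => _) = fun y => (A \o position) y i' j') //.
  by apply/funext => y; rewrite block_mxEdr.
Qed.

Lemma momentum_col_mx (a b : 'cV[R]_n) : momentum (col_mx a b) = a.
Proof. exact: col_mxKu. Qed.

Lemma position_col_mx (a b : 'cV[R]_n) : position (col_mx a b) = b.
Proof. exact: col_mxKd. Qed.

Lemma cotangent_lift_mul (X : 'M[R]_n) v :
  cotangent_lift X *m v = col_mx (X^T *m momentum v) (X *m position v).
Proof.
by rewrite -[v in LHS]vsubmxK mul_block_col !mul0mx addr0 add0r.
Qed.

Lemma OmegaE v w : Omega v w =
  ((momentum v)^T *m position w - (momentum w)^T *m position v) 0 0.
Proof.
have dotE (a b : 'cV[R]_n) : (a^T *m b) 0 0 = \sum_(q < n) a q 0 * b q 0.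
  by rewrite mxE; apply: eq_bigr => q _; rewrite mxE.
by rewrite /Omega sumrB -!dotE [RHS]mxE [X in _ = _ + X]mxE.
Qed.

(** Nondegeneracy: pairing with a basis vector extracts one coordinate. *)
Lemma Omega_inj v w : (forall z, Omega z v = Omega z w) -> v = w.
Proof.
move=> vw; rewrite -[v]vsubmxK -[w]vsubmxK; congr col_mx; apply/colP => i.
  have := vw (col_mx 0 (delta_mx i 0)).
  rewrite !OmegaE /momentum /position col_mxKu col_mxKd trmx0 !mul0mx !sub0r.
  by rewrite -!colE !mxE => /oppr_inj.
have := vw (col_mx (delta_mx i 0) 0).
rewrite !OmegaE /momentum /position col_mxKu col_mxKd !mulmx0 !subr0 trmx_delta.
by rewrite -!rowE !mxE.
Qed.

(** The derivatives of [p] give the block-diagonal part, those of [A] give the block [R]. *)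
Lemma Omega_twistedE A z v w : (forall a, derivable A (position z) a) ->
  Omega_twisted A z v w =
  Omega v (cotangent_lift (A (position z)) *m w) +
  ((momentum z)^T *m (dmx A (position z) (position v) *m position w
                    - dmx A (position z) (position w) *m position v)) 0 0.
Proof.
move=> dA.
have D v1 w1 : 'D_v1 (fun y => (twisted_liouville A y *m w1) 0 0 : R^o) z =
    (((momentum v1)^T *m A (position z)
      + (momentum z)^T *m dmx A (position z) (position v1)) *m position w1) 0 0.
  have dm : is_derive z v1 (fun y => (momentum y)^T) (momentum v1)^T.
    apply/is_derive_mxP => i j; rewrite ord1 mxE.
    rewrite (_ : (fun y => _) = fun y => momentum y j 0); first exact: is_derive_momentum.
    by apply/funext => y; rewrite mxE.
  have dAz := is_derive_position (is_derive_dmx (dA (position v1))).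
  have dw := is_derive_cst (position w1) z v1.
  have /is_derive_mxP/(_ 0 0) := is_derive_mulmx (is_derive_mulmx dm dAz) dw.
  rewrite mulmx0 addr0 => -[_ <-]; congr ('D_v1 _ z); apply/funext => y.
  by rewrite /twisted_liouville -[w1 in LHS]vsubmxK mul_row_col mul0mx add0r.
rewrite /Omega_twisted /ext_d !D OmegaE cotangent_lift_mul.
rewrite momentum_col_mx position_col_mx trmx_mul trmxK.
move: (dmx A _ _) (dmx A _ (position w)) (A _) => Dv Dw Az.
move: (momentum v)^T (momentum w)^T (momentum z)^T => pv pw pz.
move: (position v) (position w) => qv qw.
by rewrite !mulmxDl mulmxBr !mulmxA !mxE; ring.
Qed.

Lemma complete_lift_cotangent U A Ahat z :
  complete_lift U A Ahat -> cotangent_over U z ->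
  (forall a, derivable A (position z) a) ->
  (forall a b, dmx A (position z) a *m b = dmx A (position z) b *m a) ->
  Ahat z = cotangent_lift (A (position z)).
Proof.
move=> liftA Uz dA symA; suff E w : Ahat z *m w = cotangent_lift (A (position z)) *m w.
  apply/matrixP => i j; have := E (delta_mx j 0); rewrite -!colE.
  by move=> /colP/(_ i); rewrite [LHS]mxE [RHS]mxE.
apply: Omega_inj => v; rewrite (liftA z Uz) (Omega_twistedE v w dA) symA subrr mulmx0.
by rewrite [X in _ + X]mxE addr0.
Qed.

(** The momentum component cancels by the second hypothesis alone; the position component uses
    both. *)
Lemma torsion_cotangent_lift_aux (X : 'M[R]_n) (D : 'cV[R]_n -> 'M[R]_n) :
  (forall a b, D a *m b = D b *m a) -> (forall a, D (X *m a) = D a *m X) ->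
  forall v w,
  cotangent_lift (D (position (cotangent_lift X *m v))) *m w
  - cotangent_lift (D (position (cotangent_lift X *m w))) *m v
  - cotangent_lift X *m (cotangent_lift (D (position v)) *m w)
  + cotangent_lift X *m (cotangent_lift (D (position w)) *m v) = 0.
Proof.
move=> symD comD v w.
rewrite !cotangent_lift_mul !momentum_col_mx !position_col_mx !comD.
have E : D (position v) *m X *m position w = D (position w) *m X *m position v.
  by rewrite -mulmxA symD comD.
rewrite (symD (position w) (position v)) E.
move: (position v) (position w) (momentum v) (momentum w) => qv qw pv pw.
move: (D qv) (D qw) => Dv Dw.
rewrite !opp_col_mx !add_col_mx -[RHS]col_mx0 !trmx_mul !mulmxA.
by congr col_mx; apply/matrixP => i j; rewrite !mxE; ring.
Qed.

Lemma torsion_cotangent_lift A Ahat z :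
  (forall a, derivable A (position z) a) ->
  (\near z, Ahat z = cotangent_lift (A (position z))) ->
  (forall a b, dmx A (position z) a *m b = dmx A (position z) b *m a) ->
  (forall a, dmx A (position z) (A (position z) *m a) =
             dmx A (position z) a *m A (position z)) ->
  forall v w, torsion Ahat Ahat z v w = 0.
Proof.
move=> dA AhatE symA comA v w.
have dE a := is_derive_dmxE (is_derive_cotangent_lift a dA AhatE).
rewrite /torsion !dE (nbhs_singleton AhatE).
exact: torsion_cotangent_lift_aux.
Qed.

End CotangentBundle.

Theorem proposition4p1 (R : realType) (n : nat) (M : manifold R n)
    (L : operator_field M) (f : M -> R) (u : chart R M n)
    (Lhat : 'cV[R]_(n + n) -> 'M[R]_(n + n)) :
  nijenhuis L -> gl_regular L ->
  regular_conservation_law L f ->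
  second_companion_coordinates L f u ->
  complete_lift (img u) (L u) Lhat ->
  symmetry_family (img u) Lhat (momentum_operator Lhat).
Proof.
move=> nL _ _ Lfu liftL; have [cu _] := Lfu.
have sL := components_smooth L cu.
have LhatE z : cotangent_over (img u) z ->
    Lhat z = cotangent_lift (L u (position z)).
  move=> Uz; apply: (complete_lift_cotangent liftL Uz).
    exact: smooth_derivable sL Uz.
  by case: (dmx_coordinates Lfu nL Uz).
split.
  exists (fun i z => momentum z i 0); split=> // i; exact: smooth_momentum.
move=> xi eta sxi seta z Uz; pose y := position z.
have dL : forall a, derivable (L u) y a := smooth_derivable sL Uz.
have [symL comL] := dmx_coordinates Lfu nL Uz.
(* [Lhat] is determined only over [img u]; openness makes the formula hold near [z], so that it can
   be differentiated. *)
have nearE : \near z, Lhat z = cotangent_lift (L u (position z)).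
  near=> t; apply: LhatE; near: t; apply: open_nbhs_nbhs; split=> //.
  exact/open_cotangent_over/img_open.
have dLhat a := is_derive_cotangent_lift a dL nearE.
have linLhat : linear (dmx Lhat z).
  move=> c a b; rewrite !(is_derive_dmxE (dLhat _)).
  rewrite (_ : position (c *: a + b) = c *: position a + position b); last first.
    by apply/matrixP => i j; rewrite !mxE.
  rewrite (dmx_linear (smooth_differentiable sL Uz)) /cotangent_lift.
  by rewrite scale_block_mx add_block_mx !scaler0 !addr0 !linearD/= linearZ.
have torLhat := torsion_cotangent_lift dL nearE symL comL.
have powLhat := torsion_pow (fun a => @ex_derive _ _ _ _ _ _ _ (dLhat a)) torLhat.
have dp i a := is_derive_momentum z a i.
have [dP torP] := torsion_comb linLhat
  (fun (i : 'I_n) a => @ex_derive _ _ _ _ _ _ _ (dp i a))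
  (fun (i : 'I_n) a => (powLhat i).1 a).
have comm : (\sum_(i < n) momentum z i 0 *: Lhat z ^+ i) *m Lhat z =
    Lhat z *m (\sum_(i < n) momentum z i 0 *: Lhat z ^+ i).
  rewrite mulmx_suml mulmx_sumr; apply: eq_bigr => i _.
  by rewrite -scalemxAl -scalemxAr !mulmxE -exprSr -exprS.
rewrite -[momentum_operator Lhat]/(fun z => \sum_(i < n) momentum z i 0 *: Lhat z ^+ i).
rewrite (pairingE dP (fun a => @ex_derive _ _ _ _ _ _ _ (dLhat a))
  (smooth_derivable sxi Uz) (smooth_derivable seta Uz) comm).
(* The torsions of the powers vanish; the terms with derivatives of the momenta are left. *)
rewrite torP big1 ?add0r => [|i _]; last by rewrite (powLhat i).2 scaler0.
rewrite [X in X *m _](_ : _ = 0) ?mul0mx//; apply/eqP; rewrite subr_eq0; apply/eqP.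
transitivity (cotangent_lift (\sum_(i < n) momentum (eta z) i 0 *: L u y ^+ i.+1)).
  rewrite mulmx_sumr -cotangent_lift_sum; apply: eq_bigr => i _.
  rewrite -scalemxAr mulmxE -exprS (LhatE z Uz) cotangent_lift_exp.
  by rewrite (@derive_val _ _ _ _ _ _ _ (dp i (eta z))).
(* The new coefficients [(L^T b)_i], for [b] the momentum part of [eta z], are the values of [dp_i]
   on [Lhat z *m eta z]. *)
rewrite -companion_dual; last exact: (companion_coordinates Lfu Uz).
rewrite -cotangent_lift_sum; apply: eq_bigr => i _.
rewrite (@derive_val _ _ _ _ _ _ _ (dp i _)) (LhatE z Uz) cotangent_lift_exp.
by rewrite cotangent_lift_mul momentum_col_mx.
Unshelve. all: by end_near. Qed.
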